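(* Let $N=\prod_{i=1}^\ell p_i^{r_i}$ be a positive integer, where $p_1,\dots,p_\ell$ are distinct primes and $r_1,\dots,r_\ell\ge 1$. Let $\mu\ge 1$ and let $f\in\mathbb{Z}[X_1,\dots,X_\mu]$ be any $\mu$-linear polynomial that is co-prime to $N$. Then for every integer $m>1$, if $\mathbf{x}=(x_1,\dots,x_\mu)$ is sampled uniformly from $\{0,1,\dots,m-1\}^\mu$, $$\Pr_{\mathbf{x}}\big[f(\mathbf{x})\equiv 0 \pmod N\big]\;\le\;\frac{\mu}{m}+\prod_{i=1}^{\ell} I_{1/p_i}(r_i,\mu).$$
   Context: A polynomial $f\in\mathbb{Z}[X_1,\dots,X_\mu]$ is $\mu$-linear (multilinear) if it has degree at most $1$ in each variable $X_i$. $f$ is co-prime to $N$ if the greatest common divisor of $N$ and all coefficients of $f$ equals $1$. For $\epsilon\in(0,1)$ and integers $k\ge 0$, $\mu\ge 1$, the regularized (incomplete) beta function is $I_\epsilon(k,\mu)=(1-\epsilon)^\mu\sum_{j=k}^{\infty}\binom{\mu+j-1}{j}\epsilon^j$; equivalently, it is the probability that $Z_1+\dots+Z_\mu\ge k$, where $Z_1,\dots,Z_\mu$ are i.i.d. nonnegative-integer random variables with $\Pr[Z_i\ge s]=\epsilon^s$ for all $s\ge 0$. *)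

(* Defs.v *)
From HB Require Import structures.
From mathcomp Require Import all_boot all_order all_algebra.
From mathcomp Require Import all_classical all_reals all_analysis.
From mathcomp Require mpoly.
Set Implicit Arguments. Unset Strict Implicit. Unset Printing Implicit Defensive.
Import Order.TTheory GRing.Theory Num.Theory.
Local Open Scope ring_scope.

Definition multilinear (mu : nat) (f : mpoly.mpoly mu int) : Prop :=
  forall m : mpoly.multinom mu, mpoly.mcoeff m f != 0 ->
    forall i : 'I_mu, (mpoly.fun_of_multinom m i <= 1)%N.

Definition coprime_to (N : nat) (mu : nat) (f : mpoly.mpoly mu int) : Prop :=
  (\big[gcdn/N]_(m <- mpoly.msupp f) `|mpoly.mcoeff m f|)%N = 1%N.

Definition eval_at (mu m : nat) (f : mpoly.mpoly mu int) (x : {ffun 'I_mu -> 'I_m}) : int :=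
  mpoly.meval (fun i => ((x i : nat)%:Z)) f.

Definition prob_root_mod (R : realType) (N mu m : nat) (f : mpoly.mpoly mu int) : R :=
  (#|[set x : {ffun 'I_mu -> 'I_m} | (N%:Z %| eval_at f x)%Z]|)%:R / (m ^ mu)%:R.

(* regularized incomplete beta: I_eps(k,mu) = (1-eps)^mu * sum_{j>=k} C(mu+j-1,j) eps^j *)
Definition Ibeta (R : realType) (eps : R) (k mu : nat) : R :=
  (1 - eps) ^+ mu * limn (fun n => \sum_(k <= j < n) ('C(mu + j - 1, j))%:R * eps ^+ j).

(* Main.v *)
Require Import Defs.
From HB Require Import structures.
From mathcomp Require Import all_boot all_order all_algebra.
From mathcomp Require Import all_classical all_reals all_analysis.
From mathcomp Require mpoly.
From mathcomp Require Import zify ring lra.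
Set Implicit Arguments.
Unset Strict Implicit.
Unset Printing Implicit Defensive.
Import Order.TTheory GRing.Theory Num.Theory.
Import numFieldNormedType.Exports.
Import (canonicals) mpoly.
Local Open Scope ring_scope.

(** Fix the coordinates of [x] one at a time and follow the content of the
    partially evaluated polynomial.  If the content is prime to [N], then two
    values of the next coordinate that both make a divisor [q] of [N] divide
    the new content are congruent mod [q]; so this has probability at most
    [1/m + 1/q] over that coordinate, while [1/q] is the probability that
    independent geometric variables, one per prime [p] dividing [q], reach
    [logn p q].  Replacing each step by such geometric variables costs [1/m].
    After all [mu] steps, divisibility by [N] has become the event that for
    every [p] a sum of [mu] geometric variables of ratio [1/p] reaches
    [logn p N], whose probability is the product of the [Ibeta]. *)

(** * Tails of sums of geometric variables, and their link with [Ibeta] *)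

(* [geom_tail e k r] is Pr[Z_1 + ... + Z_k >= r] for i.i.d. Z_i with
   Pr[Z_i >= s] = e ^+ s; the recursion asks whether the last Z_i is 0. *)
Fixpoint geom_tail (R : pzRingType) (e : R) (k : nat) : nat -> R :=
  if k is k'.+1 then
    fix tail r :=
      if r is r'.+1 then (1 - e) * geom_tail e k' r + e * tail r' else 1
  else fun r => (r == 0)%:R.

Lemma geom_tail0 (R : pzRingType) (e : R) k : geom_tail e k 0 = 1.
Proof. by case: k. Qed.

Lemma geom_tailS (R : pzRingType) (e : R) k r :
  geom_tail e k.+1 r.+1 = (1 - e) * geom_tail e k r.+1 + e * geom_tail e k.+1 r.
Proof. by []. Qed.

(** This is the negative binomial mass at [r]; under the recursion it reduces to Pascal's rule. At
    [k = 0], truncated subtraction makes the binomial 1 for [r = 0] and 0 afterwards, as it should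
    be. *)
Lemma geom_tail_diff (R : comPzRingType) (e : R) k r :
  geom_tail e k r - geom_tail e k r.+1
  = (1 - e) ^+ k * (('C(k + r - 1, r))%:R * e ^+ r).
Proof.
elim: k r => [|k IHk] r.
  case: r => [|r]; first by rewrite /= bin0 expr0 !mul1r subr0.
  by rewrite add0n subn1 /= bin_small //= subr0 mul0r mulr0.
elim: r => [|r IHr].
  have H : (1 - e) ^+ k = 1 - geom_tail e k 1.
    by have := IHk 0%N; rewrite geom_tail0 bin0 expr0 !mulr1.
  by rewrite geom_tailS !geom_tail0 bin0 expr0 exprS H; ring.
rewrite (geom_tailS e k r.+1) {1}geom_tailS.
have -> (a b c d : R) : a * b + e * c - (a * d + e * geom_tail e k.+1 r.+1)
  = a * (b - d) + e * (c - geom_tail e k.+1 r.+1) by move=> *; ring.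
have -> : (k.+1 + r.+1 - 1 = (k + r).+1)%N by lia.
rewrite IHk IHr binS natrD !exprS.
have -> : (k + r.+1 - 1 = k + r)%N by lia.
have -> : (k.+1 + r - 1 = k + r)%N by lia.
by ring.
Qed.

Lemma geom_tail_ge0 (R : realFieldType) (e : R) k r :
  0 <= e <= 1 -> 0 <= geom_tail e k r.
Proof.
move=> /andP[e0 e1]; elim: k r => [|k IHk] r; first exact: ler0n.
elim: r => [|r IHr]; first exact: ler01.
by rewrite geom_tailS addr_ge0 // mulr_ge0 // subr_ge0.
Qed.

Lemma geom_tail_anti (R : realFieldType) (e : R) k r :
  0 <= e <= 1 -> geom_tail e k r.+1 <= geom_tail e k r.
Proof.
move=> /andP[e0 e1]; rewrite -subr_ge0 geom_tail_diff.
by rewrite !mulr_ge0 ?exprn_ge0 ?subr_ge0.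
Qed.

(** Condition on the sum of the first [k] variables: either it already reaches [r], or it equals
    [r - s.+1] and the last variable must be at least [s.+1]. *)
Lemma geom_tail_step (R : comPzRingType) (e : R) k r :
  geom_tail e k.+1 r = geom_tail e k r +
    \sum_(s < r) (geom_tail e k (r - s.+1) - geom_tail e k (r - s)) * e ^+ s.+1.
Proof.
elim: r => [|r IHr]; first by rewrite big_ord0 addr0 !geom_tail0.
rewrite geom_tailS IHr big_ord_recl /= subn0 subSS subn0 expr1.
under [in RHS]eq_bigr => s _ do rewrite /bump /= add1n !subSS exprS mulrCA.
by rewrite -mulr_sumr; ring.
Qed.

Lemma geom_tail_exp_bound (R : realFieldType) (e d : R) k :
  0 <= e -> e < d -> d < 1 ->
  exists2 C : R, 0 <= C & forall r, geom_tail e k r <= C * d ^+ r.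
Proof.
move=> e0 ed d1; have d0 : 0 < d by lra.
elim: k => [|k [C C0 IHk]].
  exists 1 => // r; rewrite mul1r /=; case: r => [|r] /=; rewrite ?expr0 //.
  by rewrite exprn_ge0 // ltW.
have de0 : 0 < d - e by rewrite subr_gt0.
(* Chosen so that [C * d <= C' * (d - e)], which lets the recursion preserve the bound; the summand
   1 covers [r = 0]. *)
pose C' := 1 + C * (d / (d - e)).
have C'0 : 0 <= C * (d / (d - e)) by rewrite mulr_ge0 // divr_ge0 // ltW.
exists C'; first by rewrite /C' addr_ge0.
elim=> [|r IHr]; first by rewrite geom_tail0 expr0 mulr1 /C' lerDl.
have C'E : C * d + e * C' <= C' * d.
  have -> : C' * d = C' * (d - e) + e * C' by ring.
  rewrite lerD2r /C' mulrDl -mulrA divfK ?gt_eqF // mul1r lerDr; exact: ltW.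
rewrite geom_tailS exprS mulrA.
have dr0 : 0 <= d ^+ r by rewrite exprn_ge0 // ltW.
apply: le_trans (ler_wpM2r dr0 C'E); rewrite [leRHS]mulrDl lerD //.
  have := IHk r.+1; rewrite exprS mulrA => H; apply: le_trans H.
  by rewrite ler_piMl ?geom_tail_ge0 //; lra.
by rewrite -mulrA ler_wpM2l.
Qed.

Local Open Scope classical_set_scope.

Lemma cvg_geom_tail (R : realType) (e : R) k :
  0 <= e < 1 -> geom_tail e k r @[r --> \oo] --> (0 : R).
Proof.
move=> /andP[e0 e1]; pose d := (1 + e) / 2.
have [||C C0 HC] := @geom_tail_exp_bound R e d k e0; rewrite /d; try lra.
apply: (@squeeze_cvgr _ _ _ _ (fun=> 0) (fun r => C * d ^+ r)).
- near=> r; rewrite HC andbT geom_tail_ge0 //; lra.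
- exact: cvg_cst.
- rewrite -[X in _ --> X](mulr0 C); apply: cvgMr; apply: cvg_expr.
  rewrite ger0_norm /d; lra.
Unshelve. all: by end_near. Qed.

Local Close Scope classical_set_scope.

(** By [geom_tail_diff] the partial sums of the series telescope, and the upper boundary term tends
    to 0. *)
Lemma Ibeta_geom_tail (R : realType) (e : R) k mu :
  0 <= e < 1 -> Ibeta e k mu = geom_tail e mu k.
Proof.
move=> e01; have e1 : (1 - e) ^+ mu != 0.
  by rewrite expf_neq0 // subr_eq0 gt_eqF //; case/andP: e01.
rewrite /Ibeta; set u := (fun n => _).
suff /(cvg_lim (@norm_hausdorff _ _)) -> :
    (u @ \oo --> ((1 - e) ^+ mu)^-1 * (geom_tail e mu k - 0))%classic.
  by rewrite subr0 mulVKf.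
have uE n : (k <= n)%N ->
    u n = ((1 - e) ^+ mu)^-1 * (geom_tail e mu k - geom_tail e mu n).
  move=> kn; apply: (canRL (mulKf e1)); rewrite /u mulr_sumr.
  under eq_bigr => j _ do rewrite -geom_tail_diff -opprB.
  by rewrite sumrN telescope_sumr // opprB.
have L : ((fun n => ((1 - e) ^+ mu)^-1 * (geom_tail e mu k - geom_tail e mu n))
    @ \oo --> ((1 - e) ^+ mu)^-1 * (geom_tail e mu k - 0))%classic.
  by apply: cvgMr; apply: cvgB; [exact: cvg_cst|exact: cvg_geom_tail].
apply: cvg_trans; last exact: L.
apply: near_eq_cvg.
by near=> n; rewrite uE //; near: n; exact: nbhs_infty_ge.
Unshelve. all: by end_near. Qed.

Arguments geom_tail : simpl never.

(** * Averaging a product of tails, one prime at a time *)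

(** Summation by parts. For antitone [g] the weights of the indicators are nonnegative, so upper
    bounds on the frequency of [s < v] bound the average of [g (r - v)]. *)
Lemma tail_decomp (R : pzRingType) (g : nat -> R) r v :
  g (r - v)%N =
  g r + \sum_(s < r) (g (r - s.+1)%N - g (r - s)%N) * (s < v)%N%:R.
Proof.
rewrite -(big_mkord xpredT
  (fun s => (g (r - s.+1)%N - g (r - s)%N) * (s < v)%N%:R)).
have [rv|/ltnW vr] := leqP r v.
  have -> : (r - v = r - r)%N by apply/eqP; rewrite subnn subn_eq0.
  rewrite (eq_big_nat _ _ (F2 := fun s => g (r - s.+1)%N - g (r - s)%N)).
    by rewrite (telescope_sumr (fun s => g (r - s)%N)) // subn0 addrC subrK.
  by move=> s /andP[_ sr]; rewrite (leq_trans sr rv) mulr1.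
rewrite (big_cat_nat (n := v)) //=.
have -> : \sum_(v <= s < r) (g (r - s.+1)%N - g (r - s)%N) * (s < v)%N%:R = 0.
  rewrite big_nat_cond big1 // => s /andP[/andP[vs _] _].
  by rewrite ltnNge vs mulr0.
rewrite addr0 (eq_big_nat _ _ (F2 := fun s => g (r - s.+1)%N - g (r - s)%N)).
  by rewrite (telescope_sumr (fun s => g (r - s)%N)) // subn0 addrC subrK.
by move=> s /andP[_ sr]; rewrite sr mulr1.
Qed.

(* The extra modulus [M] carries the divisibility by the prime powers that have
   already been split off by [tail_decomp]. *)
Lemma sum_indicator_prod_le (R : realFieldType) (I : finType) (d : I -> nat)
    (r : nat -> nat) k (ps : seq nat) (M : nat) :
  (forall i, 0 < d i)%N ->
  (forall q, (0 < q)%N -> \sum_i (q %| d i)%N%:R <= 1 + #|I|%:R / q%:R :> R) ->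
  uniq ps -> all prime ps -> (0 < M)%N -> all (coprime M) ps ->
  \sum_i (M %| d i)%N%:R *
      \prod_(p <- ps) geom_tail (p%:R^-1 : R) k (r p - logn p (d i))
    <= 1 + #|I|%:R / M%:R * \prod_(p <- ps) geom_tail (p%:R^-1 : R) k.+1 (r p).
Proof.
move=> d0 dP; elim: ps M => [|p ps IH] M /=.
  move=> _ _ M0 _; under eq_bigr do rewrite big_nil mulr1.
  by rewrite big_nil mulr1 dP.
move=> /andP[pps ups] /andP[p_pr aps] M0 /andP[Mp Mps].
set e : R := p%:R^-1.
have e01 : 0 <= e <= 1.
  by rewrite invr_ge0 ler0n invf_le1 ?ltr0n ?prime_gt0 // ler1n prime_gt0.
pose P i := \prod_(p <- ps) geom_tail (p%:R^-1 : R) k (r p - logn p (d i)).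
pose Q := \prod_(p <- ps) geom_tail (p%:R^-1 : R) k.+1 (r p).
pose g := geom_tail e k.
pose w s := g (r p - s.+1)%N - g (r p - s)%N.
have w0 (s : 'I_(r p)) : 0 <= w s.
  rewrite subr_ge0 /g; have -> : (r p - s = (r p - s.+1).+1)%N by rewrite subnSK.
  exact: geom_tail_anti.
(* The weights form a convex combination, so the error terms 1 of the inductive bounds again add up
   to 1. *)
have wS : g (r p) + \sum_(s < r p) w s = 1.
  rewrite -[RHS](geom_tail0 e k) -(subnn (r p)) -/g [RHS](tail_decomp g).
  by congr (_ + _); apply: eq_bigr => s _; rewrite ltn_ord mulr1.
(* Here [s < logn p (d i)] means that [p ^ s.+1] divides [d i]; as [p] is prime to [M], this merges
   into the modulus. *)
have E i : (M %| d i)%N%:R * \prod_(q <- p :: ps)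
      geom_tail (q%:R^-1 : R) k (r q - logn q (d i))
    = g (r p) * ((M %| d i)%N%:R * P i) +
      \sum_(s < r p) w s * ((M * p ^ s.+1 %| d i)%N%:R * P i).
  rewrite big_cons -/(P i) -/e -/g (tail_decomp g).
  rewrite mulrDl mulrDr mulr_suml mulr_sumr; congr (_ + _); first by rewrite mulrCA.
  apply: eq_bigr => s _; rewrite Gauss_dvd ?coprimeXr // pfactor_dvdn //.
  by rewrite -mulnb natrM !mulrA; congr (_ * _ * _); rewrite mulrC.
rewrite (eq_bigr _ (fun i _ => E i)) big_split /= -mulr_sumr exchange_big /=.
have IH0 := IH M ups aps M0 Mps.
have IHs (s : 'I_(r p)) : \sum_i w s * ((M * p ^ s.+1 %| d i)%N%:R * P i)
    <= w s * (1 + #|I|%:R / (M * p ^ s.+1)%N%:R * Q).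
  rewrite -mulr_sumr ler_wpM2l ?w0 // IH //.
    by rewrite muln_gt0 M0 expn_gt0 prime_gt0.
  apply/allP => q qps; rewrite coprimeMl (allP Mps) //= coprimeXl //.
  rewrite prime_coprime // dvdn_prime2 ?(allP aps q qps) //.
  by apply: contraNneq pps => ->.
have g0 : 0 <= g (r p) by apply: geom_tail_ge0.
apply: le_trans (lerD (ler_wpM2l g0 IH0) (ler_sum _ (fun s _ => IHs s))) _.
rewrite big_cons -/e -/Q geom_tail_step -/g.
have -> : \sum_(s < r p) w s * (1 + #|I|%:R / (M * p ^ s.+1)%N%:R * Q)
    = \sum_(s < r p) w s + #|I|%:R / M%:R * Q * \sum_(s < r p) w s * e ^+ s.+1.
  rewrite mulr_sumr -big_split; apply: eq_bigr => s _ /=.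
  by rewrite natrM natrX invfM exprVn; ring.
rewrite ((canRL (addKr _)) wS) le_eqVlt; apply/orP; left; apply/eqP.
by ring.
Qed.

(** * Content of a multilinear polynomial after fixing one variable *)

(* A multilinear polynomial is given by its coefficients [c]: [c b] is the
   coefficient of the product of the variables at the positions where [b] is true. *)
Definition subst_head (c : seq bool -> int) (x : int) (b : seq bool) : int :=
  c (false :: b) + x * c (true :: b).

Fixpoint mleval (c : seq bool -> int) (xs : seq int) : int :=
  if xs is x :: xs' then mleval (subst_head c x) xs' else c [::].

Fixpoint nroots (m N k : nat) (c : seq bool -> int) : nat :=
  if k is k'.+1 then \sum_(x < m) nroots m N k' (subst_head c (x : nat)%:Z)
  else (N%:Z %| c [::])%Z.

Definition gcd_coeffs (N k : nat) (c : seq bool -> int) : nat :=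
  \big[gcdn/N]_(b : k.-tuple bool) `|c b|%N.

Lemma dvdn_biggcd_seq (I : eqType) (s : seq I) (F : I -> nat) N d :
  (d %| \big[gcdn/N]_(i <- s) F i)%N = (d %| N)%N && all (fun i => d %| F i)%N s.
Proof.
by elim: s => [|i s IH]; rewrite ?big_nil ?andbT // big_cons dvdn_gcd IH /= andbCA.
Qed.

Lemma dvdn_gcd_coeffsP N k c d :
  reflect ((d %| N)%N /\ forall b, size b = k -> (d%:Z %| c b)%Z)
    (d %| gcd_coeffs N k c)%N.
Proof.
rewrite /gcd_coeffs dvdn_biggcd_seq; apply: (iffP andP) => -[dN dc]; split=> //.
  move=> b bk; have /eqP bk' := bk.
  by rewrite dvdzE /=; apply: (allP dc (Tuple bk') (mem_index_enum _)).
by apply/allP => b _; have := dc b (size_tuple b); rewrite dvdzE.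
Qed.

Lemma gcd_coeffs_dvd N k c : (gcd_coeffs N k c %| N)%N.
Proof. by have /dvdn_gcd_coeffsP[] := dvdnn (gcd_coeffs N k c). Qed.

Lemma gcd_coeffs_gt0 N k c : (0 < N)%N -> (0 < gcd_coeffs N k c)%N.
Proof. by move=> N0; apply: dvdn_gt0 N0 (gcd_coeffs_dvd N k c). Qed.

(** Subtracting the two evaluations leaves [x - y] times the coefficients involving the first
    variable, and these have no common factor with [M]. *)
Lemma gcd_coeffs_subst_head_eqmod N k c M x y :
  gcd_coeffs N k.+1 c = 1%N -> (M %| gcd_coeffs N k (subst_head c x))%N ->
  (M %| gcd_coeffs N k (subst_head c y))%N -> (M%:Z %| x - y)%Z.
Proof.
move=> c1 /dvdn_gcd_coeffsP[MN Mx] /dvdn_gcd_coeffsP[_ My].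
pose h := gcd_coeffs M k (fun b => c (true :: b)).
(* [h] divides [M], hence [subst_head c x], hence also the coefficients without
   the first variable: it divides the content of [c]. *)
have /dvdn_gcd_coeffsP[hM hc] : (h %| h)%N by [].
have h1 : h = 1%N.
  apply/eqP; rewrite -dvdn1 -c1; apply/dvdn_gcd_coeffsP; split.
    exact: dvdn_trans hM MN.
  case=> // -[] b [bk]; first exact: hc.
  have : (h%:Z %| subst_head c x b)%Z by apply: dvdz_trans (Mx b bk); rewrite dvdzE.
  by rewrite /subst_head rpredDr // dvdz_mull // hc.
rewrite -[x - y]mulr1 dvdzE abszM muln1.
have Mdiff b : size b = k -> (M%:Z %| (x - y) * c (true :: b))%Z.
  move=> bk; have := rpredB (Mx b bk) (My b bk); rewrite /subst_head.
  by have -> (a u v w : int) : a + u * w - (a + v * w) = (u - v) * w by ring.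
have : (M %| `|x - y|%N * h)%N; last by rewrite h1 muln1.
(* Divisibility of [|x - y| * g] by [M] passes from the entries of the gcd to the gcd itself. *)
apply: (big_ind (fun g => M %| `|x - y| * g)%N) => [|u v Mu Mv|b _].
- exact: dvdn_mull.
- by rewrite muln_gcdr dvdn_gcd Mu.
- by rewrite -abszM; have := Mdiff b (size_tuple b); rewrite dvdzE.
Qed.

(** The values counted lie in a single residue class mod [q], so [x %/ q] separates them. *)
Lemma gcd_coeffs_subst_head_freq (R : realFieldType) N k c m q :
  gcd_coeffs N k.+1 c = 1%N -> (0 < q)%N ->
  \sum_(x < m) (q %| gcd_coeffs N k (subst_head c (x : nat)%:Z))%N%:R
    <= 1 + m%:R / q%:R :> R.
Proof.
move=> c1 q0; case: m => [|m]; first by rewrite big_ord0 mul0r addr0.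
pose A := [pred x : 'I_m.+1 | q %| gcd_coeffs N k (subst_head c (x : nat)%:Z)]%N.
have -> : \sum_(x < m.+1) (q %| gcd_coeffs N k (subst_head c (x : nat)%:Z))%N%:R
    = #|A|%:R :> R.
  rewrite -sum1_card natr_sum [RHS]big_mkcond; apply: eq_bigr => x _.
  rewrite -[x \in A]/(q %| gcd_coeffs N k (subst_head c (x : nat)%:Z))%N.
  by case: (q %| _)%N.
have lt (x : 'I_m.+1) : (x %/ q < (m %/ q).+1)%N by rewrite ltnS leq_div2r // -ltnS.
have /leq_card_in : {in A &, injective (fun x : 'I_m.+1 => Ordinal (lt x))}.
  move=> x y Ax Ay [xyq]; apply/val_inj => /=.
  have := @gcd_coeffs_subst_head_eqmod N k c q x y c1 Ax Ay.
  rewrite -eqz_mod_dvd !modz_nat eqz_nat => /eqP xym.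
  by rewrite (divn_eq x q) (divn_eq y q) xyq xym.
rewrite card_ord -(ler_nat R) => /le_trans; apply.
rewrite -natr1 addrC lerD2l ler_pdivlMr ?ltr0n // -natrM ler_nat.
exact: leq_trans (leq_trunc_div m q) (leqnSn m).
Qed.

(** * Bounding the number of roots *)

Lemma eq_nroots m N k c c' :
  (forall b, size b = k -> c b = c' b) -> nroots m N k c = nroots m N k c'.
Proof.
elim: k c c' => [|k IH] c c' cc' /=; first by rewrite cc'.
by apply: eq_bigr => x _; apply: IH => b bk; rewrite /subst_head !cc' //= bk.
Qed.

Lemma nroots_scale (m N k : nat) c d : (0 < d)%N ->
  nroots m (N * d) k (fun b => c b * d%:Z) = nroots m N k c.
Proof.
move=> d0; elim: k c => [|k IH] c /=.
  by rewrite PoszM dvdz_mul2r // eqz_nat -lt0n.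
apply: eq_bigr => x _; rewrite -IH; apply: eq_nroots => b _.
by rewrite /subst_head mulrDl mulrA.
Qed.

(** After fixing the first coordinate to [x], divide both the polynomial and [N] by the content
    [d x]. The induction hypothesis applies to the quotients, and [sum_indicator_prod_le] with
    [M = 1] averages over [x]. *)
Lemma nroots_le (R : realFieldType) m N k c (ps : seq nat) :
  (0 < m)%N -> (0 < N)%N -> uniq ps -> all prime ps -> gcd_coeffs N k c = 1%N ->
  (nroots m N k c)%:R / (m ^ k)%:R <= k%:R / m%:R +
   \prod_(p <- ps) geom_tail (p%:R^-1 : R) k (logn p N).
Proof.
move=> m0 + ups pps; have m0R : m%:R != 0 :> R by rewrite pnatr_eq0 -lt0n.
elim: k N c => [|k IH] N c N0 c1.
  rewrite expn0 divr1 mul0r add0r /=.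
  (* A constant prime to [N] is divisible by [N] only if [N = 1], and then every tail is taken at 0
     and equals 1. *)
  have [Nc|_] := boolP (_ %| _)%Z; last first.
    by apply: prodr_ge0 => p _; exact: ler0n.
  have -> : N = 1%N.
    apply/eqP; rewrite -dvdn1 -c1; apply/dvdn_gcd_coeffsP; split=> //.
    by move=> b /size0nil ->.
  by rewrite big1 // => p _; rewrite logn1.
pose d (x : 'I_m) := gcd_coeffs N k (subst_head c (x : nat)%:Z).
have d0 x : (0 < d x)%N by exact: gcd_coeffs_gt0.
have step (x : 'I_m) :
    (nroots m N k (subst_head c (x : nat)%:Z))%:R / (m ^ k)%:R <= k%:R / m%:R +
    \prod_(p <- ps) geom_tail (p%:R^-1 : R) k (logn p N - logn p (d x)).
  have /dvdn_gcd_coeffsP[dN dc] : (d x %| d x)%N by [].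
  pose c' b := (subst_head c (x : nat)%:Z b %/ (d x)%:Z)%Z.
  have c'E b : size b = k -> subst_head c (x : nat)%:Z b = c' b * (d x)%:Z.
    by move=> bk; rewrite divzK // dc.
  rewrite (eq_nroots _ _ c'E) -[in nroots _ _](divnK dN) nroots_scale //.
  under eq_bigr do rewrite -logn_div //.
  apply: IH; first by rewrite divn_gt0 // dvdn_leq.
  set d' := gcd_coeffs _ _ _; have /dvdn_gcd_coeffsP[d'N d'c] : (d' %| d')%N by [].
  (* A common factor [d'] left in the quotients would make [d' * d x] divide the content [d x]. *)
  have : (d' * d x %| 1 * d x)%N; last by rewrite dvdn_pmul2r // dvdn1 => /eqP.
  rewrite mul1n; apply/dvdn_gcd_coeffsP; split.
    by rewrite -(divnK dN) dvdn_pmul2r.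
  by move=> b bk; rewrite c'E // PoszM dvdz_mul // d'c.
rewrite /= natr_sum expnS natrM invfM mulrCA mulr_suml mulrC.
have sumE := ler_sum _ (fun x (_ : true) => step x).
apply: le_trans (ler_wpM2r _ (sumE (index_enum _))) _; first by rewrite invr_ge0.
rewrite big_split sumr_const card_ord /= -[X in X *+ _]mulr1 -mulrnAr.
have dP q : (0 < q)%N -> \sum_x (q %| d x)%N%:R <= 1 + #|'I_m|%:R / q%:R :> R.
  by rewrite card_ord; exact: gcd_coeffs_subst_head_freq.
have all1 : all (coprime 1) ps by apply/allP => p _; rewrite coprime1n.
have := sum_indicator_prod_le (logn^~ N) k d0 dP ups pps (ltn0Sn 0) all1.
rewrite card_ord divr1.
under [X in X <= _ -> _]eq_bigr => x _ do rewrite dvd1n mul1r.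
set S := \sum_x _; set Q := \prod_(p <- ps) _ => SQ.
(* Multiplied by [m], the additive 1 in [SQ] is what raises [k] to [k.+1]. *)
rewrite divfK // ler_pdivrMr ?ltr0n // mulrDl divfK // -natr1 -addrA lerD2l.
by rewrite [Q * _]mulrC.
Qed.


(** * From [mpoly] to coefficients indexed by bit sequences *)

Lemma sum_cons_tuple (V : nmodType) (T : finType) k (F : seq T -> V) :
  \sum_(t : k.+1.-tuple T) F t = \sum_x \sum_(t : k.-tuple T) F (x :: t).
Proof.
rewrite pair_bigA /=.
rewrite (reindex (fun p : T * k.-tuple T => [tuple of p.1 :: p.2])) //=.
exists (fun t : k.+1.-tuple T => (thead t, [tuple of behead t])).
  by move=> [x t] _; congr pair; apply/val_inj.
by move=> t _; apply/val_inj; rewrite /= [in RHS](tuple_eta t).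
Qed.

Lemma sum_tuple0 (V : nmodType) (T : finType) (F : seq T -> V) :
  \sum_(t : 0.-tuple T) F t = F [::].
Proof.
rewrite (big_pred1 [tuple]) // => t.
by apply/esym/eqP; apply/val_inj; rewrite tuple0.
Qed.

Lemma nrootsE m N k c :
  nroots m N k c =
  (\sum_(t : k.-tuple 'I_m) (N%:Z %| mleval c [seq (nat_of_ord i)%:Z | i <- t])%Z)%N.
Proof.
elim: k c => [|k IH] c.
  by rewrite (sum_tuple0 (fun t : seq 'I_m =>
       nat_of_bool (N%:Z %| mleval c [seq (nat_of_ord i)%:Z | i <- t])%Z)).
rewrite (sum_cons_tuple k (fun t : seq 'I_m =>
       nat_of_bool (N%:Z %| mleval c [seq (nat_of_ord i)%:Z | i <- t])%Z)) /=.
by apply: eq_bigr => x _; rewrite IH.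
Qed.

Lemma mlevalE k c xs : size xs = k ->
  mleval c xs =
  \sum_(b : k.-tuple bool) c b * \prod_(i < k) xs`_i ^+ nth false b i.
Proof.
elim: k c xs => [|k IH] c.
  move=> xs /size0nil->; rewrite (sum_tuple0 (fun b : seq bool =>
    c b * \prod_(i < 0) [::]`_i ^+ nth false b i)) /=.
  by rewrite big_ord0 mulr1.
case=> [//|x xs] [xsk] /=.
rewrite (sum_cons_tuple k (fun b : seq bool =>
   c b * \prod_(i < k.+1) (x :: xs)`_i ^+ nth false b i)) big_bool /= IH //.
rewrite -big_split /=; apply: eq_bigr => b _.
by rewrite !big_ord_recl /= expr0 expr1 /subst_head; ring.
Qed.

Definition mnm_of_bits mu (b : seq bool) : mpoly.multinom mu :=
  mpoly.Multinom [tuple nat_of_bool (nth false b i) | i < mu].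

Lemma mnm_of_bitsE mu b i :
  mpoly.fun_of_multinom (mnm_of_bits mu b) i = nth false b i.
Proof. by rewrite mpoly.multinomE tnth_mktuple. Qed.

Lemma mnm_of_bits_inj mu : injective (fun b : mu.-tuple bool => mnm_of_bits mu b).
Proof.
move=> b b' bb'; apply: eq_from_tnth => i; rewrite !(tnth_nth false).
have := congr1 (fun M => mpoly.fun_of_multinom M i) bb'.
by rewrite /= !mnm_of_bitsE; do 2!case: nth.
Qed.

Lemma mnm_of_bits_onto mu (M : mpoly.multinom mu) :
  (forall i, mpoly.fun_of_multinom M i <= 1)%N ->
  exists b : mu.-tuple bool, M = mnm_of_bits mu b.
Proof.
move=> M1; exists [tuple (0 < mpoly.fun_of_multinom M i)%N | i < mu].
apply/mpoly.mnmP => i; rewrite mnm_of_bitsE -tnth_nth tnth_mktuple.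
by case: (mpoly.fun_of_multinom M i) (M1 i) => [|[]].
Qed.

(** Multilinearity puts every monomial of the support among the images of bit tuples; the remaining
    bit tuples have coefficient 0. *)
Lemma sum_msupp_multilinear (mu : nat) (f : mpoly.mpoly mu int)
    (F : mpoly.multinom mu -> int) :
  multilinear f ->
  \sum_(M <- mpoly.msupp f) mpoly.mcoeff M f * F M =
  \sum_(b : mu.-tuple bool)
    mpoly.mcoeff (mnm_of_bits mu b) f * F (mnm_of_bits mu b).
Proof.
move=> fml.
rewrite -(big_map (fun b : mu.-tuple bool => mnm_of_bits mu b) xpredT
   (fun M => mpoly.mcoeff M f * F M)) /=.
rewrite [RHS](bigID (fun M : mpoly.multinom mu => M \in mpoly.msupp f)) /=.
rewrite [X in _ + X]big1 ?addr0; last first.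
  by move=> M /mpoly.memN_msupp_eq0 ->; rewrite mul0r.
rewrite -[RHS]big_filter; apply: perm_big; apply: uniq_perm.
- exact: mpoly.msupp_uniq.
- by rewrite filter_uniq // map_inj_uniq ?index_enum_uniq //; exact: mnm_of_bits_inj.
move=> M; rewrite mem_filter; case Mf: (M \in mpoly.msupp f) => //=.
have [|b ->] := @mnm_of_bits_onto mu M.
  by apply: fml; rewrite -mpoly.mcoeff_msupp.
by apply/esym/mapP; exists b; rewrite ?mem_index_enum.
Qed.

Lemma eval_at_mleval (mu m : nat) (f : mpoly.mpoly mu int)
    (x : {ffun 'I_mu -> 'I_m}) : multilinear f ->
  eval_at f x = mleval (fun b => mpoly.mcoeff (mnm_of_bits mu b) f)
                  [seq (nat_of_ord i)%:Z | i <- tuple_of_finfun x].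
Proof.
move=> fml; rewrite (@mlevalE mu); last by rewrite size_map size_tuple.
rewrite /eval_at mpoly.mevalE (sum_msupp_multilinear (fun M =>
  \prod_i ((x i : nat)%:Z) ^+ mpoly.fun_of_multinom M i)) //.
apply: eq_bigr => b _; congr (_ * _); apply: eq_bigr => i _.
rewrite mnm_of_bitsE (nth_map (x i)) ?size_tuple //.
have xiE : nth (x i) (tuple_of_finfun x) i = x i.
  by rewrite -tnth_nth tnth_mktuple.
by rewrite xiE.
Qed.

Lemma gcd_coeffs_mcoeff N mu (f : mpoly.mpoly mu int) :
  multilinear f -> coprime_to N f ->
  gcd_coeffs N mu (fun b => mpoly.mcoeff (mnm_of_bits mu b) f) = 1%N.
Proof.
move=> fml f1; set c := fun b => _; apply/eqP; rewrite -dvdn1 -f1.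
have /dvdn_gcd_coeffsP[dN dc] : (gcd_coeffs N mu c %| gcd_coeffs N mu c)%N by [].
rewrite dvdn_biggcd_seq dN; apply/allP => M; rewrite mpoly.mcoeff_msupp => fM.
have [b ->] := mnm_of_bits_onto (fml M fM).
by have := dc b (size_tuple b); rewrite dvdzE.
Qed.

Theorem theorem1 (R : realType) (N mu : nat) (f : mpoly.mpoly mu int) (m : nat) :
  (0 < N)%N -> (1 <= mu)%N -> multilinear f -> coprime_to N f -> (1 < m)%N ->
  prob_root_mod R N m f <=
    mu%:R / m%:R + \prod_(p <- primes N) Ibeta (p%:R^-1 : R) (logn p N) mu.
Proof.
move=> N0 _ fml f1 m1.
pose c b := mpoly.mcoeff (mnm_of_bits mu b) f.
have rootsE : #|[set x : {ffun 'I_mu -> 'I_m} | (N%:Z %| eval_at f x)%Z]|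
    = nroots m N mu c.
  rewrite nrootsE -sum1dep_card big_mkcond /=.
  rewrite (reindex (@tuple_of_finfun 'I_m mu)) /=; last first.
    apply: onW_bij; exists (@finfun_of_tuple 'I_m mu).
      exact: tuple_of_finfunK.
    exact: finfun_of_tupleK.
  by apply: eq_bigr => x _; rewrite eval_at_mleval //; case: ifP => ->.
have pP : all prime (primes N) by apply/allP => p; rewrite mem_primes => /andP[].
rewrite /prob_root_mod rootsE (eq_big_seq (fun p : nat =>
  geom_tail (p%:R^-1 : R) mu (logn p N))); last first.
  move=> p /(allP pP) p_pr; apply: Ibeta_geom_tail.
  by rewrite invr_ge0 ler0n invf_lt1 ?ltr0n ?ltr1n ?prime_gt0 ?prime_gt1.
by apply: nroots_le => //; [exact: ltnW|exact: primes_uniq|exact: gcd_coeffs_mcoeff].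
Qed.
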